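(* Assume the standing hypotheses on $H$ (Conditions A, B, C, in particular $\Lambda^{\sup}<\infty$; no assumption on $\Lambda^{\inf}$) and suppose $k>1$. Let $0<T<\infty$, let $h:\mathbb{R}^n\to\mathbb{R}$ be continuous with $\inf_{\mathbb{R}^n}h>-\infty$, let $\chi:(0,T)\to\mathbb{R}$ be bounded and continuous, let $\sigma\ge0$, and let $Z:\mathbb{R}\to[0,\infty)$ be non-increasing and continuous. Let $u$ be lower semicontinuous on $\mathbb{R}^n\times[0,T)$, be a viscosity super-solution of $\mathcal{P}_\sigma(t,u,u_t,Du,D^2u)\le 0$ in $\mathbb{R}^n_T$, and satisfy $u(x,0)\ge h(x)$ for all $x$. Fix $z\in\mathbb{R}^n$ and suppose $\sup_{B^R_T}(-u)=o(R^\beta)$ as $R\to\infty$. (a) If $0\le\sigma\le\gamma/2$ and $\beta=\gamma^*$, then for all $(x,t)\in\mathbb{R}^n_T$: $u(x,t)\ge\inf_{\mathbb{R}^n}h-t\sup_{(0,T)}|\chi|$ when $\sigma=0$, and $u(x,t)\ge\inf_{\mathbb{R}^n}h$ when $0<\sigma\le\gamma/2$. (b) If $\sigma>\gamma/2$ and $\beta=\sigma^*$, then $u(x,t)\ge\inf_{\mathbb{R}^n}h$ for all $(x,t)\in\mathbb{R}^n_T$.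
   Context: Let $n\ge2$, let $S^{n\times n}$ denote the real symmetric $n\times n$ matrices with the usual partial order, $I$ the identity, $O$ the zero matrix, and for a unit vector $e$ let $(e\otimes e)_{ij}=e_ie_j$. $H:\mathbb{R}^n\times S^{n\times n}\to\mathbb{R}$ is continuous and satisfies: Condition A: $H(q,X)\le H(q,Y)$ whenever $X\le Y$, and $H(q,O)=0$ for all $q$. Condition B: there is $k_1\ge0$ with $H(\theta q,X)=|\theta|^{k_1}H(q,X)$ for all $\theta\in\mathbb{R}$ and $H(q,\theta X)=\theta H(q,X)$ for all $\theta>0$. Condition C: $\max_{|e|=1}H(e,-I)<0<\min_{|e|=1}H(e,I)$ and $\Lambda^{\sup}:=\sup_{\lambda\in\mathbb{R}}\max_{|e|=1}H(e,\lambda e\otimes e+I)<\infty$. Also $\Lambda^{\inf}:=\inf_{\lambda}\min_{|e|=1}H(e,\lambda e\otimes e-I)$. Set $k=k_1+1$, $\gamma=k+1$, and for $k>1$, $\gamma^*=\gamma/(\gamma-2)$; for $\sigma>1$, $\sigma^*=\sigma/(\sigma-1)$. $\mathbb{R}^n_T=\mathbb{R}^n\times(0,T)$, and for fixed $z$, $B^R_T=\{(x,t):|x-z|\le R,\ 0<t<T\}$. The operator is $\mathcal{P}_\sigma(t,u,u_t,Du,D^2u)=H(Du,D^2u+Z(u)Du\otimes Du)+\chi(t)|Du|^\sigma-u_t$, with the convention $|q|^0=1$. Solutions, sub-solutions and super-solutions are in the viscosity sense. *)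

(* Defs.v *)
From Stdlib Require Import Reals.
From mathcomp Require Import ssreflect ssrbool ssrfun eqtype ssrnat fintype bigop.
Set Implicit Arguments.
Unset Strict Implicit.
Unset Printing Implicit Defensive.
Local Open Scope R_scope.

Definition Vec (n : nat) := 'I_n -> R.
Definition Mat (n : nat) := 'I_n -> 'I_n -> R.

Definition vadd n (x y : Vec n) : Vec n := fun i => x i + y i.
Definition vsub n (x y : Vec n) : Vec n := fun i => x i - y i.
Definition vscal n (a : R) (x : Vec n) : Vec n := fun i => a * x i.
Definition basis n (i : 'I_n) : Vec n := fun j => if j == i then 1 else 0.
Definition dot n (x y : Vec n) : R := \big[Rplus/0]_(i < n) (x i * y i).
Definition vnorm n (x : Vec n) : R := sqrt (dot x x).

Definition madd n (X Y : Mat n) : Mat n := fun i j => X i j + Y i j.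
Definition mscal n (a : R) (X : Mat n) : Mat n := fun i j => a * X i j.
Definition idm n : Mat n := fun i j => if i == j then 1 else 0.
Definition zerom n : Mat n := fun _ _ => 0.
Definition tensor n (p q : Vec n) : Mat n := fun i j => p i * q j.
Definition symmetric n (X : Mat n) : Prop := forall i j, X i j = X j i.
Definition quad n (X : Mat n) (v : Vec n) : R :=
  \big[Rplus/0]_(i < n) \big[Rplus/0]_(j < n) (v i * X i j * v j).
Definition mle n (X Y : Mat n) : Prop := forall v : Vec n, quad X v <= quad Y v.

(* |x|^a for x >= 0, a >= 0, with the convention |q|^0 = 1 (also at q = 0) *)
Definition rpow (x a : R) : R :=
  if Req_EM_T x 0 then (if Req_EM_T a 0 then 1 else 0) else Rpower x a.

Definition H_continuous n (H : Vec n -> Mat n -> R) : Prop :=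
  forall (q : Vec n) (X : Mat n), symmetric X ->
  forall eps, 0 < eps -> exists delta, 0 < delta /\
    forall (q' : Vec n) (X' : Mat n), symmetric X' ->
      (forall i, Rabs (q' i - q i) < delta) ->
      (forall i j, Rabs (X' i j - X i j) < delta) ->
      Rabs (H q' X' - H q X) < eps.

Definition condA n (H : Vec n -> Mat n -> R) : Prop :=
  (forall q X Y, symmetric X -> symmetric Y -> mle X Y -> H q X <= H q Y) /\
  (forall q, H q (@zerom n) = 0).

Definition condB n (H : Vec n -> Mat n -> R) (k1 : R) : Prop :=
  0 <= k1 /\
  (forall (theta : R) q X, symmetric X ->
      H (vscal theta q) X = rpow (Rabs theta) k1 * H q X) /\
  (forall (theta : R) q X, symmetric X -> 0 < theta ->
      H q (mscal theta X) = theta * H q X).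

Definition unit_vec n (e : Vec n) : Prop := vnorm e = 1.

Definition condC n (H : Vec n -> Mat n -> R) : Prop :=
  (exists e0, unit_vec e0 /\ H e0 (mscal (-1) (@idm n)) < 0 /\
     forall e, unit_vec e -> H e (mscal (-1) (@idm n)) <= H e0 (mscal (-1) (@idm n))) /\
  (exists e0, unit_vec e0 /\ 0 < H e0 (@idm n) /\
     forall e, unit_vec e -> H e0 (@idm n) <= H e (@idm n)) /\
  (exists M, forall (lam : R) e, unit_vec e ->
      H e (madd (mscal lam (tensor e e)) (@idm n)) <= M).

Definition is_glb (E : R -> Prop) (m : R) : Prop :=
  (forall y, E y -> m <= y) /\ (forall b, (forall y, E y -> b <= y) -> b <= m).

Definition jcont n (f : Vec n -> R -> R) : Prop :=
  forall x t eps, 0 < eps -> exists delta, 0 < delta /\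
    forall y s, (forall i, Rabs (y i - x i) < delta) -> Rabs (s - t) < delta ->
      Rabs (f y s - f x t) < eps.

Definition C21 n (phi : Vec n -> R -> R) (Dphi : Vec n -> R -> Vec n)
  (D2phi : Vec n -> R -> Mat n) (phit : Vec n -> R -> R) : Prop :=
  (forall x t i, derivable_pt_lim (fun s => phi (vadd x (vscal s (basis i))) t) 0
                   (Dphi x t i)) /\
  (forall x t i j, derivable_pt_lim (fun s => Dphi (vadd x (vscal s (basis j))) t i) 0
                   (D2phi x t i j)) /\
  (forall x t, derivable_pt_lim (fun s => phi x (t + s)) 0 (phit x t)) /\
  jcont phi /\ (forall i, jcont (fun x t => Dphi x t i)) /\
  (forall i j, jcont (fun x t => D2phi x t i j)) /\ jcont phit.

Definition Psigma n (H : Vec n -> Mat n -> R) (chi Z : R -> R) (sigma : R)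
  (t r a : R) (p : Vec n) (X : Mat n) : R :=
  H p (madd X (mscal (Z r) (tensor p p))) + chi t * rpow (vnorm p) sigma - a.

Definition visc_super n (H : Vec n -> Mat n -> R) (chi Z : R -> R) (sigma T : R)
  (u : Vec n -> R -> R) : Prop :=
  forall x0 t0, 0 < t0 < T ->
  forall phi Dphi D2phi phit, C21 phi Dphi D2phi phit ->
  (exists r, 0 < r /\ forall y s, vnorm (vsub y x0) < r -> Rabs (s - t0) < r ->
       0 < s < T -> u x0 t0 - phi x0 t0 <= u y s - phi y s) ->
  Psigma H chi Z sigma t0 (u x0 t0) (phit x0 t0) (Dphi x0 t0) (D2phi x0 t0) <= 0.

Definition lsc_on n (T : R) (u : Vec n -> R -> R) : Prop :=
  forall x t, 0 <= t < T -> forall eps, 0 < eps -> exists delta, 0 < delta /\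
    forall y s, 0 <= s < T -> vnorm (vsub y x) < delta -> Rabs (s - t) < delta ->
      u x t - eps < u y s.

Definition cyl n (z : Vec n) (R0 T : R) (x : Vec n) (t : R) : Prop :=
  vnorm (vsub x z) <= R0 /\ 0 < t < T.

Definition growth_o n (u : Vec n -> R -> R) (z : Vec n) (T beta : R) : Prop :=
  forall eps, 0 < eps -> exists R0, 0 < R0 /\ forall R1, R0 <= R1 ->
    exists S, is_lub (fun y => exists x t, cyl z R1 T x t /\ y = - u x t) S /\
      Rabs S <= eps * Rpower R1 beta.

Definition vcont n (f : Vec n -> R) : Prop :=
  forall x eps, 0 < eps -> exists delta, 0 < delta /\
    forall y, (forall i, Rabs (y i - x i) < delta) -> Rabs (f y - f x) < eps.

(* Main.v *)
(* Write s = 1 + |x - z|^2 and phi = m - a t - E(t) s^(beta/2), E(t) = e0 (1 + t/T).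
   As Z >= 0 and H is monotone, the Z-term can be dropped and D^2 phi replaced by
   a negative multiple of I, so H(D phi, .) >= - C E^(k1+1) s^(beta/2) exactly
   when (beta - 1) k1 <= 2.  With |D phi|^(beta/(beta-1)) <= C E^(beta/(beta-1)) s^(beta/2),
   Young's inequality M y^sigma <= a + C1 y^(beta/(beta-1)) absorbs the chi-term.
   Both error terms are superlinear in e0, whereas - phi_t gains (e0/T) s^(beta/2):
   for small e0, phi is a strict sub-solution.  The growth condition puts phi below u
   for large |x|, and phi <= u initially, so phi <= u; then let e0 tend to 0.
   Case (a) has a = sup |chi| if sigma = 0 and a arbitrarily small otherwise;
   case (b) has beta/(beta-1) = sigma and a = 0. *)
Require Import Defs.
From Stdlib Require Import Reals Lra FunctionalExtensionality.
From mathcomp Require Import ssreflect ssrbool ssrfun eqtype ssrnat fintype bigop.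
From mathcomp Require ssralg ssrnum interval classical_sets topology normedtype.
From mathcomp Require Rstruct Rstruct_topology.
Set Implicit Arguments.
Unset Strict Implicit.
Local Open Scope R_scope.

(** * Minima of lower semicontinuous functions on cylinders *)

Section Compactness.
Import ssralg ssrnum interval classical_sets topology normedtype Rstruct_topology.
Import numFieldNormedType.Exports.
Local Open Scope classical_set_scope.

(** Semicontinuity is taken relative to [A] because that of [u] is known only for times in
    [[0, T)]. *)
Lemma compact_lsc_attains_min (T : topologicalType) (A : set T) (f : T -> R) :
  compact A -> A !=set0 ->
  (forall p, A p -> forall eps, 0 < eps -> nbhs p [set q | A q -> f p - eps < f q]) ->
  exists p, A p /\ forall q, A q -> f p <= f q.
Proof.
move=> cA [a Aa] lsc.
(* A cluster point of the filter generated by the sublevel sets is a minimizer. *)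
pose F : set_system T :=
  [set S | exists q, A q /\ forall p, A p -> f p <= f q -> S p].
have FF : ProperFilter F.
  split.
    by move=> [q [Aq]]; apply; [exact: Aq | right].
  split.
  - by exists a.
  - move=> P Q [p [Ap Pp]] [q [Aq Qq]].
    case: (Rle_dec (f p) (f q)) => pq.
      exists p; split=> // x Ax xp; split; [exact: Pp|apply: Qq => //; lra].
    exists q; split=> // x Ax xq; split; [apply: Pp => //; lra|exact: Qq].
  - by move=> P Q PQ [p [Ap Pp]]; exists p; split=> // x Ax xp; apply/PQ/Pp.
have FA : F A by exists a.
have [p [Ap clp]] := cA F FF FA.
exists p; split=> // q Aq.
apply: Rnot_lt_le => qp.
have d0 : 0 < f p - f q by lra.
have Fq : F [set x | A x /\ f x <= f q] by exists q.
(* With [eps = f p - f q], points of [A] near [p] have values above [f q], yet this neighbourhood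
   must meet the sublevel set of level [f q]. *)
have [x [[Ax xq] /(_ Ax) xp]] := clp _ _ Fq (lsc p Ap _ d0).
lra.
Qed.

(** Boxes are used instead of balls: a box is a product of segments, so Tychonoff's theorem applies
    directly to the function type [Vec n]. *)
Lemma box_compact (n : nat) (z : Vec n) (r : R) :
  compact [set x : prod_topology (fun _ : 'I_n => R) |
           forall i, `[z i - r, z i + r]%classic (x i)].
Proof.
apply: (@tychonoff _ (fun _ : 'I_n => R : topologicalType)
          (fun i => `[z i - r, z i + r])) => i.
exact: segment_compact.
Qed.

Lemma nbhs_coord (n : nat) (x : Vec n) (d : R) : 0 < d ->
  nbhs (x : prod_topology (fun _ : 'I_n => R)) [set y | forall i, Rabs (y i - x i) < d].
Proof.
move=> d0.
have H (i : 'I_n) : nbhs (x : prod_topology (fun _ : 'I_n => R)) [set y | Rabs (y i - x i) < d].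
  have xB : nbhs (x i) [set c | Rabs (c - x i) < d].
    exists d; first exact/RltP.
    by move=> c /= /RltP; rewrite -RabsE -RminusE Rabs_minus_sym.
  exact: (@proj_continuous 'I_n (fun _ => R : topologicalType) i x _ xB).
have := @filter_forall _ _ _ (nbhs (x : prod_topology (fun _ : 'I_n => R))) _ H.
exact.
Qed.

(** Restates compactness in epsilon-delta terms for the comparison argument. The time segment
    contains 0, so the initial time has to be excluded separately there. *)
Lemma box_cylinder_min (n : nat) (z : Vec n) (r s : R) (f : Vec n -> R -> R) :
  0 <= r -> 0 <= s ->
  (forall x t, (forall i, Rabs (x i - z i) <= r) -> 0 <= t <= s ->
    forall eps, 0 < eps -> exists delta, 0 < delta /\
      forall y t', 0 <= t' <= s -> (forall i, Rabs (y i - x i) < delta) ->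
        Rabs (t' - t) < delta -> f x t - eps < f y t') ->
  exists x t, (forall i, Rabs (x i - z i) <= r) /\ 0 <= t <= s /\
    forall y t', (forall i, Rabs (y i - z i) <= r) -> 0 <= t' <= s -> f x t <= f y t'.
Proof.
move=> r0 s0 lsc.
have inI (a b c : R) : `[a, b]%classic c <-> a <= c <= b.
  rewrite /= in_itv /=; split.
    by move=> /andP[/RleP ? /RleP ?].
  by move=> [? ?]; apply/andP; split; apply/RleP.
have inB (i : 'I_n) (x : R) : `[z i - r, z i + r]%classic x <-> Rabs (x - z i) <= r.
  rewrite inI; by split; split_Rabs; lra.
have cD := compact_setX (@box_compact n z r) (@segment_compact _ (IZR 0) s).
have [||[x t] [[/= xB /inI tI] xmin]] :=
  @compact_lsc_attains_min _ _
    (fun p : prod_topology (fun _ : 'I_n => R : topologicalType) * R => f p.1 p.2) cD.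
- exists (z, 0); split=> /= [i|]; last by apply/inI; lra.
  by apply/inB; rewrite Rminus_diag Rabs_R0.
- move=> [x t] [/= xB /inI tI] eps eps0.
  have xB' i : Rabs (x i - z i) <= r by apply/inB; exact: xB.
  have [d [d0 dP]] := lsc x t xB' tI eps eps0.
  exists ([set y | forall i, Rabs (y i - x i) < d], [set t' | Rabs (t' - t) < d]).
    split=> /=; first exact: nbhs_coord.
    exists d; first exact/RltP.
    by move=> y /= /RltP; rewrite -RabsE -RminusE Rabs_minus_sym.
  by move=> [y t'] [/= yd td] [_ /inI t'I]; apply: dP.
exists x, t; split; first by move=> i; apply/inB; exact: xB.
split=> // y t' yB t'I.
by apply: (xmin (y, t')); split=> [i|]; [apply/inB|apply/inI].
Qed.
End Compactness.

(** * Euclidean vectors and joint continuity *)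

Section RealSums.
Import Rstruct.

Lemma Rsum_split (I : Type) (r : list I) (F G : I -> R) :
  \big[Rplus/0]_(i <- r) (F i + G i) =
  \big[Rplus/0]_(i <- r) F i + \big[Rplus/0]_(i <- r) G i.
Proof. exact: big_split. Qed.

Lemma Rsum_scal (I : Type) (r : list I) (c : R) (F : I -> R) :
  \big[Rplus/0]_(i <- r) (c * F i) = c * \big[Rplus/0]_(i <- r) F i.
Proof.
elim: r => [|i r IH]; first by rewrite !big_nil; lra.
rewrite !big_cons IH; lra.
Qed.

Lemma Rsum_ge0 (I : Type) (r : list I) (F : I -> R) :
  (forall i, 0 <= F i) -> 0 <= \big[Rplus/0]_(i <- r) F i.
Proof.
move=> F0; elim: r => [|i r IH]; rewrite ?big_nil ?big_cons; first lra.
have := F0 i; lra.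
Qed.

Lemma Rsum_basis (n : nat) (k : 'I_n) (F : 'I_n -> R) :
  \big[Rplus/0]_(i < n) (F i * basis k i) = F k.
Proof.
rewrite (bigD1 k) //= /basis eqxx big1 => [|i /negbTE ->]; last by rewrite Rmult_0_r.
by rewrite Rmult_1_r Rplus_0_r.
Qed.

Lemma Rsum_ge_term (n : nat) (k : 'I_n) (F : 'I_n -> R) :
  (forall i, 0 <= F i) -> F k <= \big[Rplus/0]_(i < n) F i.
Proof.
move=> F0; rewrite (bigD1 k) //= big_mkcond /=.
rewrite -{1}(Rplus_0_r (F k)); apply: Rplus_le_compat_l.
by apply: Rsum_ge0 => i; case: ifP => _ //; lra.
Qed.
End RealSums.

Lemma dotC n (x y : Vec n) : dot x y = dot y x.
Proof. by apply: eq_bigr => i _; lra. Qed.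

Lemma dotDl n (x y v : Vec n) : dot (vadd x y) v = dot x v + dot y v.
Proof. by rewrite -Rsum_split; apply: eq_bigr => i _; rewrite /vadd; lra. Qed.

Lemma dotZl n (a : R) (x v : Vec n) : dot (vscal a x) v = a * dot x v.
Proof. by rewrite -Rsum_scal; apply: eq_bigr => i _; rewrite /vscal; lra. Qed.

Lemma dotDr n (x y v : Vec n) : dot v (vadd x y) = dot v x + dot v y.
Proof. by rewrite !(dotC v) dotDl. Qed.

Lemma dotZr n (a : R) (x v : Vec n) : dot v (vscal a x) = a * dot v x.
Proof. by rewrite !(dotC v) dotZl. Qed.

Lemma dot_basis n (x : Vec n) i : dot x (basis i) = x i.
Proof. exact: Rsum_basis. Qed.

Lemma dot_ge0 n (x : Vec n) : 0 <= dot x x.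
Proof. by apply: Rsum_ge0 => i; apply: Rle_0_sqr. Qed.

(** The polynomial [|y + s x|^2] in [s] is non-negative; its value at the vertex gives the
    inequality. *)
Lemma cauchy_schwarz n (x y : Vec n) : dot x y * dot x y <= dot x x * dot y y.
Proof.
have x0 := dot_ge0 x; have y0 := dot_ge0 y.
have P s : 0 <= dot y y + 2 * s * dot x y + s * s * dot x x.
  have := dot_ge0 (vadd y (vscal s x)).
  rewrite dotDl !dotDr !dotZl !dotZr (dotC y x) => ?; lra.
case: (Req_dec (dot x x) 0) => [E|N].
  case: (Req_dec (dot x y) 0) => [->|N]; first by rewrite E; lra.
  (* If [dot x x = 0], the polynomial is affine in [s], and this [s] would give it the value -1. *)
  have := P (- (dot y y + 1) / (2 * dot x y)); rewrite E.
  have -> : 2 * (- (dot y y + 1) / (2 * dot x y)) * dot x y = - (dot y y + 1) by field.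
  lra.
have p : 0 < dot x x by lra.
have := P (- dot x y / dot x x).
have -> : dot y y + 2 * (- dot x y / dot x x) * dot x y +
   - dot x y / dot x x * (- dot x y / dot x x) * dot x x =
   (dot x x * dot y y - dot x y * dot x y) / dot x x by field; lra.
move=> Q; have := Rmult_le_compat_r _ _ _ x0 Q.
have -> : (dot x x * dot y y - dot x y * dot x y) / dot x x * dot x x =
  dot x x * dot y y - dot x y * dot x y by field; lra.
lra.
Qed.

Lemma vnorm_ge0 n (x : Vec n) : 0 <= vnorm x.
Proof. exact: sqrt_pos. Qed.

Lemma vnorm_sqr n (x : Vec n) : vnorm x * vnorm x = dot x x.
Proof. by apply: sqrt_sqrt; apply: dot_ge0. Qed.

Lemma vnorm_lt n (x : Vec n) (c : R) : 0 < c -> dot x x < c * c -> vnorm x < c.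
Proof.
by move=> c0 xc; rewrite -(sqrt_square c); [apply: sqrt_lt_1; [exact: dot_ge0|nra|]|lra].
Qed.

Lemma vnormZ n (a : R) (x : Vec n) : vnorm (vscal a x) = Rabs a * vnorm x.
Proof.
rewrite /vnorm dotZl dotZr -Rmult_assoc sqrt_mult; last exact: dot_ge0.
  by rewrite -(sqrt_Rsqr_abs a).
exact: Rle_0_sqr.
Qed.

Lemma coord_le_vnorm n (x : Vec n) i : Rabs (x i) <= vnorm x.
Proof.
rewrite -sqrt_Rsqr_abs; apply: sqrt_le_1_alt.
apply: (@Rsum_ge_term _ i (fun i => x i * x i)) => j.
exact: Rle_0_sqr.
Qed.

Lemma quadD n (X Y : Mat n) v : quad (madd X Y) v = quad X v + quad Y v.
Proof.
rewrite -Rsum_split; apply: eq_bigr => i _.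
by rewrite -Rsum_split; apply: eq_bigr => j _; rewrite /madd; lra.
Qed.

Lemma quadZ n (a : R) (X : Mat n) v : quad (mscal a X) v = a * quad X v.
Proof.
rewrite -Rsum_scal; apply: eq_bigr => i _.
by rewrite -Rsum_scal; apply: eq_bigr => j _; rewrite /mscal; lra.
Qed.

Lemma quad_idm n (v : Vec n) : quad (@idm n) v = dot v v.
Proof.
apply: eq_bigr => i _; rewrite -(Rsum_basis i (fun j => v i * v j)).
apply: eq_bigr => j _; rewrite /idm /basis (eq_sym j i); case: eqP => _; lra.
Qed.

Lemma quad_tensor n (p v : Vec n) : quad (tensor p p) v = dot p v * dot p v.
Proof.
rewrite {1}/dot Rmult_comm -Rsum_scal; apply: eq_bigr => i _.
rewrite Rmult_comm -Rsum_scal; apply: eq_bigr => j _; rewrite /tensor; lra.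
Qed.

(** * Closure properties of joint continuity *)

Lemma jcont_ext n (f g : Vec n -> R -> R) :
  (forall x t, f x t = g x t) -> jcont f -> jcont g.
Proof.
move=> fg fc x t eps e0; have [d [d0 dP]] := fc x t eps e0.
by exists d; split=> // y s yd sd; rewrite -!fg; apply: dP.
Qed.

Lemma jcont_const n (c : R) : jcont (fun (_ : Vec n) _ => c).
Proof.
move=> x t eps e0; exists 1; split; first lra.
by move=> *; rewrite Rminus_diag Rabs_R0.
Qed.

Lemma jcont_coord n (i : 'I_n) : jcont (fun x _ => x i).
Proof. by move=> x t eps e0; exists eps. Qed.

Lemma jcont_comp n (g : R -> R) (f : Vec n -> R -> R) :
  (forall x t, continuity_pt g (f x t)) -> jcont f -> jcont (fun x t => g (f x t)).
Proof.
move=> gc fc x t eps e0.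
have [d1 [d10 d1P]] := gc x t eps e0.
have [d [d0 dP]] := fc x t d1 d10.
exists d; split=> // y s yd sd.
(* [continuity_pt] speaks only of points different from the base point, so equal values are treated
   apart. *)
case: (Req_dec (f y s) (f x t)) => [->|N]; first by rewrite Rminus_diag Rabs_R0.
apply: (d1P (f y s)); split; last exact: dP.
by split=> //; apply: not_eq_sym.
Qed.

Lemma jcont_time n (g : R -> R) : continuity g -> jcont (fun (_ : Vec n) t => g t).
Proof.
move=> gc; apply: (@jcont_comp _ g (fun _ t => t)) => // x t eps e0.
by exists eps.
Qed.

Lemma jcont_plus n (f g : Vec n -> R -> R) :
  jcont f -> jcont g -> jcont (fun x t => f x t + g x t).
Proof.
move=> fc gc x t eps e0.
have [|d1 [d10 P1]] := fc x t (eps / 2); first lra.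
have [|d2 [d20 P2]] := gc x t (eps / 2); first lra.
exists (Rmin d1 d2); split; first exact: Rmin_pos.
have m1 := Rmin_l d1 d2; have m2 := Rmin_r d1 d2.
move=> y s yd sd.
have {}P1 := P1 y s (fun i => Rlt_le_trans _ _ _ (yd i) m1) (Rlt_le_trans _ _ _ sd m1).
have {}P2 := P2 y s (fun i => Rlt_le_trans _ _ _ (yd i) m2) (Rlt_le_trans _ _ _ sd m2).
split_Rabs; lra.
Qed.

Lemma jcont_mult n (f g : Vec n -> R -> R) :
  jcont f -> jcont g -> jcont (fun x t => f x t * g x t).
Proof.
move=> fc gc x t eps e0.
have a0 := Rabs_pos (f x t); have b0 := Rabs_pos (g x t).
(* Since [e <= 1], the product of the two increments is at most [e], so the total error is at most
   [e * (|f| + |g| + 1)]. *)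
set e := Rmin 1 (eps / (Rabs (f x t) + Rabs (g x t) + 1)).
have e1 : e <= 1 by exact: Rmin_l.
have ee : e * (Rabs (f x t) + Rabs (g x t) + 1) <= eps.
  have -> : eps = eps / (Rabs (f x t) + Rabs (g x t) + 1) * (Rabs (f x t) + Rabs (g x t) + 1).
    by field; lra.
  apply: Rmult_le_compat_r; [lra|exact: Rmin_r].
have ep : 0 < e by apply: Rmin_pos; [lra|apply: Rdiv_lt_0_compat; lra].
have [d1 [d10 P1]] := fc x t e ep.
have [d2 [d20 P2]] := gc x t e ep.
exists (Rmin d1 d2); split; first exact: Rmin_pos.
have m1 := Rmin_l d1 d2; have m2 := Rmin_r d1 d2.
move=> y s yd sd.
have {}P1 := P1 y s (fun i => Rlt_le_trans _ _ _ (yd i) m1) (Rlt_le_trans _ _ _ sd m1).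
have {}P2 := P2 y s (fun i => Rlt_le_trans _ _ _ (yd i) m2) (Rlt_le_trans _ _ _ sd m2).
have -> : f y s * g y s - f x t * g x t =
  (f y s - f x t) * (g y s - g x t) + f x t * (g y s - g x t) + g x t * (f y s - f x t) by ring.
have := Rabs_triang ((f y s - f x t) * (g y s - g x t) + f x t * (g y s - g x t))
  (g x t * (f y s - f x t)).
have := Rabs_triang ((f y s - f x t) * (g y s - g x t)) (f x t * (g y s - g x t)).
rewrite !Rabs_mult.
have := Rabs_pos (f y s - f x t); have := Rabs_pos (g y s - g x t).
nra.
Qed.

Lemma jcont_sum n (I : Type) (r : list I) (F : I -> Vec n -> R -> R) :
  (forall i, jcont (F i)) -> jcont (fun x t => \big[Rplus/0]_(i <- r) F i x t).
Proof.
move=> Fc; elim: r => [|i r IH].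
  by apply: (@jcont_ext _ (fun _ _ => 0)) => [x t|]; [rewrite big_nil|exact: jcont_const].
apply: (@jcont_ext _ (fun x t => F i x t + \big[Rplus/0]_(i <- r) F i x t)) => [x t|].
  by rewrite big_cons.
exact: jcont_plus.
Qed.

Lemma jcont_shift n (z : Vec n) i : jcont (fun x _ => vsub x z i).
Proof. by apply: jcont_plus; [exact: jcont_coord|exact: jcont_const]. Qed.

Lemma jcont_dist2 n (z : Vec n) : jcont (fun x _ => dot (vsub x z) (vsub x z)).
Proof. by apply: jcont_sum => i; apply: jcont_mult; apply: jcont_shift. Qed.

(** Links the coordinatewise neighbourhoods of [jcont] to the Euclidean balls of [lsc_on]. *)
Lemma vnorm_small n (x : Vec n) (eps : R) : 0 < eps ->
  exists delta, 0 < delta /\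
    forall y, (forall i, Rabs (y i - x i) < delta) -> vnorm (vsub y x) < eps.
Proof.
move=> e0; have [|d [d0 dP]] := @jcont_dist2 n x x 0 (eps * eps); first nra.
exists d; split=> // y yd; apply: vnorm_lt => //.
have := dP y 0 yd; rewrite Rminus_diag Rabs_R0 => /(_ d0).
have -> : dot (vsub x x) (vsub x x) = 0.
  have -> : vsub x x = vscal 0 x by apply: functional_extensionality => i; rewrite /vsub /vscal; lra.
  by rewrite dotZl; lra.
have := dot_ge0 (vsub y x); split_Rabs; lra.
Qed.

(** * Real powers *)

Lemma Rpower_pos x a : 0 < Rpower x a.
Proof. exact: exp_pos. Qed.

Lemma Rpower_incr x y a : 0 < x -> x <= y -> 0 <= a -> Rpower x a <= Rpower y a.
Proof. by move=> x0 xy a0; apply: Rle_Rpower_l. Qed.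

Lemma Rpower_decr x y a : 0 < x -> x <= y -> a <= 0 -> Rpower y a <= Rpower x a.
Proof.
move=> x0 xy a0.
rewrite -(Ropp_involutive a) (Rpower_Ropp y) (Rpower_Ropp x).
apply: Rinv_le_contravar; first exact: Rpower_pos.
apply: Rpower_incr => //; lra.
Qed.

Lemma Rpower_0 x : Rpower x 0 = 1.
Proof. by rewrite /Rpower Rmult_0_l exp_0. Qed.

Lemma rpow_pos x a : 0 < x -> rpow x a = Rpower x a.
Proof. by rewrite /rpow; case: Req_EM_T => [E ?|//]; lra. Qed.

Lemma rpow_0l a : 0 < a -> rpow 0 a = 0.
Proof.
move=> a0; rewrite /rpow; case: Req_EM_T => [?|//].
by case: Req_EM_T => [E|//]; lra.
Qed.

Lemma rpow_0r x : rpow x 0 = 1.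
Proof.
rewrite /rpow; case: Req_EM_T => ?; last exact: Rpower_0.
by case: Req_EM_T.
Qed.

Lemma rpow_ge0 x a : 0 <= rpow x a.
Proof.
rewrite /rpow; case: Req_EM_T => ?; last exact/Rlt_le/Rpower_pos.
by case: Req_EM_T => ? /=; lra.
Qed.

Lemma rpow_le_Rpower x y a : 0 < a -> 0 <= x -> x <= y -> 0 < y ->
  rpow x a <= Rpower y a.
Proof.
move=> a0 [x0|<-] xy y0.
  by rewrite rpow_pos //; apply: Rpower_incr; lra.
by rewrite rpow_0l //; apply/Rlt_le/Rpower_pos.
Qed.

Lemma Rpower_small C a tau : 0 <= C -> 0 < a -> 0 < tau ->
  exists d, 0 < d /\ forall x, 0 < x <= d -> C * Rpower x a <= tau.
Proof.
move=> C0 a0 t0.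
have p : 0 < tau / (C + 1) by apply: Rdiv_lt_0_compat; lra.
(* Dividing by [C + 1] rather than [C] also covers [C = 0]. *)
exists (Rpower (tau / (C + 1)) (/ a)); split; first exact: Rpower_pos.
move=> x [x0 xd].
have : Rpower x a <= tau / (C + 1).
  have -> : tau / (C + 1) = Rpower (Rpower (tau / (C + 1)) (/ a)) a.
    by rewrite Rpower_mult Rinv_l ?Rpower_1 //; lra.
  by apply: Rpower_incr => //; lra.
have : C * (tau / (C + 1)) = tau - tau / (C + 1) by field; lra.
have := Rpower_pos x a; nra.
Qed.

(** Below a threshold [y0] the left side is at most [delta]; above it,
    [y^(sigma - p) <= y0^(sigma - p)] because [sigma <= p]. Equality [sigma = p] is allowed, as the
    endpoint of case (a) requires. *)
Lemma young_rpow M sigma p delta : 0 <= M -> 0 < sigma <= p -> 0 < delta ->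
  exists C, 0 <= C /\ forall y, 0 <= y -> M * rpow y sigma <= delta + C * rpow y p.
Proof.
move=> M0 [s0 sp] d0.
have [y0 [y00 y0P]] := Rpower_small M0 s0 d0.
exists (M * Rpower y0 (sigma - p)); split.
  by apply: Rmult_le_pos => //; apply/Rlt_le/Rpower_pos.
move=> y [yp|<-]; last by rewrite !rpow_0l; lra.
rewrite !rpow_pos //.
have R1 := Rpower_pos y0 (sigma - p); have R2 := Rpower_pos y p.
case: (Rle_lt_dec y y0) => yy.
  have := y0P y (conj yp yy).
  have : 0 <= M * Rpower y0 (sigma - p) * Rpower y p.
    by apply: Rmult_le_pos; [apply: Rmult_le_pos|]; lra.
  lra.
have -> : Rpower y sigma = Rpower y (sigma - p) * Rpower y p.
  by rewrite -Rpower_plus; congr Rpower; lra.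
have := @Rpower_decr y0 y (sigma - p) y00 (Rlt_le _ _ yy).
move=> /(_ ltac:(lra)) Q.
have : M * (Rpower y (sigma - p) * Rpower y p) <= M * (Rpower y0 (sigma - p) * Rpower y p).
  by apply: Rmult_le_compat_l => //; apply: Rmult_le_compat_r; lra.
lra.
Qed.

(* Since [k1 > 0], [H] vanishes at [q = 0]; continuity there, rescaled by
   homogeneity, replaces the compactness of the unit sphere. *)
Lemma H_neg_idm_lower_bound n (H : Vec n -> Mat n -> R) k1 :
  H_continuous H -> condB H k1 -> 0 < k1 ->
  exists C, 0 <= C /\ forall q c, 0 < c ->
    - (C * rpow (vnorm q) k1 * c) <= H q (mscal (- c) (@idm n)).
Proof.
move=> Hc [_ [Hq HX]] k0.
have symI c : Defs.symmetric (mscal c (@idm n)).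
  by move=> i j; rewrite /mscal /idm eq_sym.
have H0 q X : Defs.symmetric X -> (forall i, q i = 0) -> H q X = 0.
  move=> sX q0; have -> : q = vscal 0 q.
    by apply: functional_extensionality => i; rewrite /vscal q0; lra.
  by rewrite Hq // Rabs_R0 rpow_0l //; lra.
have [d [d0 dP]] := Hc (fun _ => 0) _ (symI (-1)) 1 Rlt_0_1.
(* A nonzero [q] is rescaled to length [d / 2], where [|H| < 1] at [-I]; undoing the scaling
   multiplies by [(2 |q| / d)^k1]. *)
exists (Rpower (2 / d) k1); split; first exact/Rlt_le/Rpower_pos.
move=> q c c0.
have -> : mscal (- c) (@idm n) = mscal c (mscal (-1) (@idm n)).
  by do 2 (apply: functional_extensionality => ?); rewrite /mscal; lra.
rewrite HX //.
suff : - (Rpower (2 / d) k1 * rpow (vnorm q) k1) <= H q (mscal (-1) (@idm n)) by nra.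
case: (vnorm_ge0 q) => [N0|N0]; last first.
  rewrite -N0 rpow_0l // H0 // => [|i]; first lra.
  have := coord_le_vnorm q i; rewrite -N0; split_Rabs; lra.
have := dP (vscal (d / (2 * vnorm q)) q) _ (symI (-1)).
have th0 : 0 < d / (2 * vnorm q) by apply: Rdiv_lt_0_compat; lra.
rewrite (H0 (fun _ => 0)) // Hq // (Rabs_pos_eq _ (Rlt_le _ _ th0)) !rpow_pos //.
have P := Rpower_pos (d / (2 * vnorm q)) k1.
have E : Rpower (2 / d) k1 * Rpower (vnorm q) k1 * Rpower (d / (2 * vnorm q)) k1 = 1.
  have p1 : 0 < 2 / d by apply: Rdiv_lt_0_compat; lra.
  have p2 : 0 < 2 / d * vnorm q by exact: Rmult_lt_0_compat.
  rewrite !Rpower_mult_distr //.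
  have -> : 2 / d * vnorm q * (d / (2 * vnorm q)) = 1 by field; lra.
  by rewrite /Rpower ln_1 Rmult_0_r exp_0.
move=> K.
have {}K : Rabs (Rpower (d / (2 * vnorm q)) k1 * H q (mscal (-1) (@idm n)) - 0) < 1.
  apply: K => [i|i j]; last by rewrite Rminus_diag Rabs_R0.
  rewrite /vscal Rminus_0_r Rabs_mult (Rabs_pos_eq _ (Rlt_le _ _ th0)).
  have : d / (2 * vnorm q) * Rabs (q i) <= d / (2 * vnorm q) * vnorm q.
    by apply: Rmult_le_compat_l; [lra|exact: coord_le_vnorm].
  have -> : d / (2 * vnorm q) * vnorm q = d / 2 by field; lra.
  lra.
have : Rpower (d / (2 * vnorm q)) k1 * - (Rpower (2 / d) k1 * Rpower (vnorm q) k1)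
  <= Rpower (d / (2 * vnorm q)) k1 * H q (mscal (-1) (@idm n)).
  by split_Rabs; lra.
exact: Rmult_le_reg_l.
Qed.

(** * The barrier and its derivatives *)

(** The square of the Japanese bracket of [x - z]. Being smooth and at least 1, it has smooth real
    powers even at [x = z], and these increase with the exponent. *)
Definition japanese n (z x : Vec n) : R := 1 + dot (vsub x z) (vsub x z).

Lemma japanese_ge1 n (z x : Vec n) : 1 <= japanese z x.
Proof. by have := dot_ge0 (vsub x z); rewrite /japanese; lra. Qed.

Lemma japanese_shift n (z x : Vec n) i s :
  japanese z (vadd x (vscal s (basis i))) =
  japanese z x + 2 * s * vsub x z i + s * s.
Proof.
rewrite /japanese; have -> : vsub (vadd x (vscal s (basis i))) z = vadd (vsub x z) (vscal s (basis i)).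
  by apply: functional_extensionality => j; rewrite /vsub /vadd; lra.
rewrite dotDl !(dotDr (vsub x z)) !dotZl !dotZr (dotC (basis i) (vsub x z)) !dot_basis.
by rewrite /basis eqxx; lra.
Qed.

Lemma jcont_Rpower_japanese n (z : Vec n) b : jcont (fun x _ => Rpower (japanese z x) b).
Proof.
apply: (@jcont_comp _ (fun y => Rpower y b) (fun x _ => japanese z x)) => [x _|].
  apply: derivable_continuous_pt; exists (b * Rpower (japanese z x) (b - 1)).
  by apply: derivable_pt_lim_power; have := japanese_ge1 z x; lra.
by apply: jcont_plus; [exact: jcont_const|exact: jcont_dist2].
Qed.

Lemma derivable_pt_lim_ext f g x l :
  (forall y, f y = g y) -> derivable_pt_lim f x l -> derivable_pt_lim g x l.
Proof. by move=> /functional_extensionality ->. Qed.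

Lemma derivable_Rpower_japanese n (z x : Vec n) b i :
  derivable_pt_lim (fun s => Rpower (japanese z (vadd x (vscal s (basis i)))) b) 0
    (2 * b * Rpower (japanese z x) (b - 1) * vsub x z i).
Proof.
pose g s := japanese z x + 2 * s * vsub x z i + s * s.
have g0 : g 0 = japanese z x by rewrite /g; lra.
have dg : derivable_pt_lim g 0 (2 * vsub x z i).
  have -> : 2 * vsub x z i = 0 + (2 * 1 * vsub x z i) + (1 * id 0 + id 0 * 1) by rewrite /id; lra.
  apply: (@derivable_pt_lim_plus (fun s => japanese z x + 2 * s * vsub x z i)
    (fun s => s * s)); last first.
    by apply: (@derivable_pt_lim_mult id id); apply: derivable_pt_lim_id.
  apply: (@derivable_pt_lim_plus (fun s => japanese z x) (fun s => 2 * s * vsub x z i)).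
    exact: derivable_pt_lim_const.
  apply: (@derivable_pt_lim_ext (mult_real_fct (2 * vsub x z i) id)).
    by move=> y; rewrite /mult_real_fct /id; lra.
  have -> : 2 * 1 * vsub x z i = 2 * vsub x z i * 1 by lra.
  exact: derivable_pt_lim_scal (derivable_pt_lim_id 0).
apply: (@derivable_pt_lim_ext (comp (fun y => Rpower y b) g)) => [s|].
  by rewrite /comp japanese_shift.
have -> : 2 * b * Rpower (japanese z x) (b - 1) * vsub x z i =
  b * Rpower (g 0) (b - 1) * (2 * vsub x z i) by rewrite g0; ring.
apply: derivable_pt_lim_comp => //; apply: derivable_pt_lim_power.
by rewrite g0; have := japanese_ge1 z x; lra.
Qed.

(** The profiles [A] and [E] are left free, so the same formula with their derivatives expresses the
    time derivative. *)
Definition barrier n (b : R) (z : Vec n) (A E : R -> R) (x : Vec n) (t : R) : R :=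
  A t - E t * Rpower (japanese z x) b.

Definition Dbarrier n (b : R) (z : Vec n) (E : R -> R) (x : Vec n) (t : R) : Vec n :=
  vscal (- (E t * (2 * b) * Rpower (japanese z x) (b - 1))) (vsub x z).

Definition D2barrier n (b : R) (z : Vec n) (E : R -> R) (x : Vec n) (t : R) : Mat n :=
  mscal (- (E t * (2 * b)))
    (madd (mscal (Rpower (japanese z x) (b - 1)) (@idm n))
       (mscal (2 * (b - 1) * Rpower (japanese z x) (b - 2))
          (tensor (vsub x z) (vsub x z)))).

Lemma C21_barrier n b (z : Vec n) (A E A' E' : R -> R) :
  (forall t, derivable_pt_lim A t (A' t)) ->
  (forall t, derivable_pt_lim E t (E' t)) ->
  continuity A' -> continuity E' ->
  C21 (barrier b z A E) (Dbarrier b z E) (D2barrier b z E) (barrier b z A' E').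
Proof.
move=> dA dE cA' cE'.
have cA : continuity A by move=> t; apply: derivable_continuous_pt; exists (A' t); exact: dA.
have cE : continuity E by move=> t; apply: derivable_continuous_pt; exists (E' t); exact: dE.
have jb (A0 E0 : R -> R) : continuity A0 -> continuity E0 -> jcont (barrier b z A0 E0).
  move=> cA0 cE0; apply: (@jcont_ext _ (fun x t => A0 t + (-1) * (E0 t * Rpower (japanese z x) b))).
    by move=> x t; rewrite /barrier; lra.
  apply: jcont_plus; first exact: jcont_time.
  apply: jcont_mult; first exact: jcont_const.
  by apply: jcont_mult; [exact: jcont_time|exact: jcont_Rpower_japanese].
do 6 (try split).
- move=> x t i.
  pose F s := mult_real_fct (- E t)
    (fun s => Rpower (japanese z (vadd x (vscal s (basis i)))) b) s.
  apply: (@derivable_pt_lim_ext (fun s => A t + F s)) => [s|].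
    by rewrite /F /barrier /mult_real_fct; lra.
  have -> : Dbarrier b z E x t i = 0 + - E t * (2 * b * Rpower (japanese z x) (b - 1) * vsub x z i).
    by rewrite /Dbarrier /vscal; lra.
  apply: (@derivable_pt_lim_plus (fun _ => A t) F); first exact: derivable_pt_lim_const.
  by apply: derivable_pt_lim_scal; apply: derivable_Rpower_japanese.
- move=> x t i j.
  pose G s := vsub x z i + s * basis j i.
  pose F s := Rpower (japanese z (vadd x (vscal s (basis j)))) (b - 1).
  apply: (@derivable_pt_lim_ext (mult_real_fct (- (E t * (2 * b))) (mult_fct F G))) => [s|].
    by rewrite /F /G /Dbarrier /mult_real_fct /mult_fct /vscal /vsub /vadd; lra.
  have F0 : F 0 = Rpower (japanese z x) (b - 1).
    by rewrite /F japanese_shift; congr Rpower; lra.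
  have G0 : G 0 = vsub x z i by rewrite /G; lra.
  have -> : D2barrier b z E x t i j = - (E t * (2 * b)) *
    (2 * (b - 1) * Rpower (japanese z x) (b - 1 - 1) * vsub x z j * G 0 + F 0 * basis j i).
    rewrite F0 G0 /D2barrier /mscal /madd /tensor /idm /basis.
    have -> : b - 1 - 1 = b - 2 by lra.
    by case: (i == j); lra.
  apply: derivable_pt_lim_scal; apply: derivable_pt_lim_mult; first exact: derivable_Rpower_japanese.
  have -> : basis j i = 0 + basis j i * 1 by lra.
  apply: (@derivable_pt_lim_plus (fun _ => vsub x z i) (fun s => s * basis j i)).
    exact: derivable_pt_lim_const.
  apply: (@derivable_pt_lim_ext (mult_real_fct (basis j i) id)).
    by move=> y; rewrite /mult_real_fct /id; lra.
  exact: derivable_pt_lim_scal (derivable_pt_lim_id 0).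
- have shift (f f' : R -> R) t : derivable_pt_lim f t (f' t) ->
    derivable_pt_lim (fun s => f (t + s)) 0 (f' t).
    move=> df eps e0; have [d dP] := df eps e0.
    exists d => h h0 hd; rewrite Rplus_0_l Rplus_0_r; exact: dP.
  move=> x t.
  pose F s := mult_real_fct (- Rpower (japanese z x) b) (fun s => E (t + s)) s.
  apply: (@derivable_pt_lim_ext (fun s => A (t + s) + F s)) => [s|].
    by rewrite /F /barrier /mult_real_fct; lra.
  have -> : barrier b z A' E' x t = A' t + - Rpower (japanese z x) b * E' t.
    by rewrite /barrier; lra.
  apply: (@derivable_pt_lim_plus (fun s => A (t + s)) F); first exact: shift.
  by apply: derivable_pt_lim_scal; apply: shift.
- exact: jb.
- move=> i.
  apply: (@jcont_ext _ (fun x t => (- (2 * b)) * (E t * (Rpower (japanese z x) (b - 1) * vsub x z i)))).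
    by move=> x t; rewrite /Dbarrier /vscal; lra.
  apply: jcont_mult; first exact: jcont_const.
  apply: jcont_mult; first exact: jcont_time.
  by apply: jcont_mult; [exact: jcont_Rpower_japanese|exact: jcont_shift].
- move=> i j.
  apply: (@jcont_ext _ (fun x t => (- (2 * b)) * (E t * (Rpower (japanese z x) (b - 1) * @idm n i j
     + (2 * (b - 1)) * (Rpower (japanese z x) (b - 2) * (vsub x z i * vsub x z j)))))).
    by move=> x t; rewrite /D2barrier /mscal /madd /tensor; lra.
  apply: jcont_mult; first exact: jcont_const.
  apply: jcont_mult; first exact: jcont_time.
  apply: jcont_plus.
    by apply: jcont_mult; [exact: jcont_Rpower_japanese|exact: jcont_const].
  apply: jcont_mult; first exact: jcont_const.
  apply: jcont_mult; first exact: jcont_Rpower_japanese.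
  by apply: jcont_mult; apply: jcont_shift.
- exact: jb.
Qed.

(** * Comparison *)

(** The term [r p p^T] is non-negative, and Cauchy-Schwarz bounds [(x - z)(x - z)^T] by
    [|x - z|^2 I], which raises [s^(b - 2)] to [s^(b - 1)]. The absolute value treats both signs of
    [b - 1] at once. *)
Lemma D2barrier_ge n b (z : Vec n) E x t r (p : Vec n) :
  0 <= E t -> 0 <= b -> 0 <= r ->
  mle (mscal (- (E t * (2 * b) * (1 + 2 * Rabs (b - 1)) * Rpower (japanese z x) (b - 1))) (@idm n))
    (madd (D2barrier b z E x t) (mscal r (tensor p p))).
Proof.
move=> E0 b0 r0 v; rewrite /D2barrier quadD !quadZ quadD !quadZ !quad_tensor !quad_idm.
have s1 := japanese_ge1 z x.
have cs := cauchy_schwarz (vsub x z) v.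
have v0 := dot_ge0 v.
have -> : Rpower (japanese z x) (b - 1) = Rpower (japanese z x) (b - 2) * japanese z x.
  rewrite -{3}(Rpower_1 (japanese z x)); last lra.
  by rewrite -Rpower_plus; congr Rpower; lra.
have P := Rpower_pos (japanese z x) (b - 2).
set Q := Rpower _ (b - 2) in P *.
set D := dot (vsub x z) v in cs *.
have : D * D <= japanese z x * dot v v by rewrite /japanese; nra.
set s := japanese z x in s1 *; set V := dot v v in v0 cs *.
move=> DV; have D0 : 0 <= D * D by apply: Rle_0_sqr.
have pp : 0 <= r * (dot p v * dot p v) by apply: Rmult_le_pos => //; apply: Rle_0_sqr.
have Eb : 0 <= E t * (2 * b) by apply: Rmult_le_pos; lra.
have B : (b - 1) * (D * D) <= Rabs (b - 1) * (s * V).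
  have := Rle_abs (b - 1); have := Rabs_pos (b - 1); nra.
suff : 0 <= E t * (2 * b) * (2 * Q * (Rabs (b - 1) * (s * V) - (b - 1) * (D * D))) by lra.
by apply: Rmult_le_pos => //; apply: Rmult_le_pos; lra.
Qed.

Lemma vnorm_Dbarrier_le n b (z : Vec n) E x t : 0 <= E t -> 0 <= b ->
  vnorm (Dbarrier b z E x t) <= 2 * b * E t * Rpower (japanese z x) (b - / 2).
Proof.
move=> E0 b0; rewrite /Dbarrier vnormZ Rabs_Ropp.
have s1 := japanese_ge1 z x.
have P := Rpower_pos (japanese z x) (b - 1).
have Eb : 0 <= E t * (2 * b) by apply: Rmult_le_pos; lra.
rewrite Rabs_pos_eq; last by apply: Rmult_le_pos; lra.
have -> : b - / 2 = (b - 1) + / 2 by lra.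
rewrite Rpower_plus Rpower_sqrt; last lra.
have : vnorm (vsub x z) <= sqrt (japanese z x).
  by apply: sqrt_le_1_alt; rewrite /japanese; lra.
have : 0 <= E t * (2 * b) * Rpower (japanese z x) (b - 1) by apply: Rmult_le_pos; lra.
nra.
Qed.

(** [r] will be the value of [u] and [v] the time derivative of the barrier. Each error term is
    written as [E t] times a further positive power of [beta * E t], so that it is negligible
    against a multiple of [E t] when [E t] is small. *)
Lemma Psigma_barrier_ge n (H : Vec n -> Mat n -> R) chi Z k1 sigma beta (z : Vec n) E C a M C1 x t r v :
  condA H -> 0 < k1 ->
  (forall q c, 0 < c -> - (C * rpow (vnorm q) k1 * c) <= H q (mscal (- c) (@idm n))) ->
  0 <= C -> 1 < beta -> (beta - 1) * k1 <= 2 ->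
  0 <= C1 -> Rabs (chi t) <= M ->
  (forall y, 0 <= y -> M * rpow y sigma <= a + C1 * rpow y (beta / (beta - 1))) ->
  0 < E t -> 0 <= Z r ->
  - a - v - E t * (C * (beta * (1 + 2 * Rabs (beta / 2 - 1))) * Rpower (beta * E t) k1
     + C1 * beta * Rpower (beta * E t) (/ (beta - 1))) * Rpower (japanese z x) (beta / 2)
  <= Psigma H chi Z sigma t r v (Dbarrier (beta / 2) z E x t) (D2barrier (beta / 2) z E x t).
Proof.
move=> [Hmono _] k0 HC C0 b1 bk C10 chiM young E0 Z0.
set p := Dbarrier _ _ _ _ _; set s := japanese z x; set b := beta / 2.
have s1 : 1 <= s by exact: japanese_ge1.
have pn : vnorm p <= beta * E t * Rpower s (b - / 2).
  have -> : beta = 2 * b by rewrite /b; lra.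
  by apply: vnorm_Dbarrier_le; rewrite /b; lra.
have p0 := vnorm_ge0 p.
have bE : 0 < beta * E t by apply: Rmult_lt_0_compat; lra.
have bound q : 0 < q -> rpow (vnorm p) q <= Rpower (beta * E t) q * Rpower s ((b - / 2) * q).
  move=> q0; rewrite -Rpower_mult Rpower_mult_distr //; last exact: Rpower_pos.
  by apply: rpow_le_Rpower => //; apply: Rmult_lt_0_compat => //; apply: Rpower_pos.
have sb := Rpower_pos s b.
have Hterm : - (E t * (C * (beta * (1 + 2 * Rabs (b - 1))) * Rpower (beta * E t) k1) * Rpower s b)
    <= H p (madd (D2barrier b z E x t) (mscal (Z r) (tensor p p))).
  set L := E t * (2 * b) * (1 + 2 * Rabs (b - 1)) * Rpower s (b - 1).
  have B0 := Rabs_pos (b - 1).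
  have EB : 0 < E t * (2 * b) * (1 + 2 * Rabs (b - 1)).
    by apply: Rmult_lt_0_compat; [apply: Rmult_lt_0_compat; rewrite /b|]; lra.
  have L0 : 0 < L by apply: Rmult_lt_0_compat => //; apply: Rpower_pos.
  apply: (Rle_trans _ (H p (mscal (- L) (@idm n)))); last first.
    apply: Hmono.
    - by move=> i j; rewrite /mscal /idm eq_sym.
    - move=> i j; rewrite /madd /D2barrier /mscal /madd /tensor /idm (eq_sym j i); lra.
    - by apply: D2barrier_ge => //; rewrite /b; lra.
  apply: Rle_trans (HC p L L0); apply: Ropp_le_contravar.
  have := bound k1 k0.
  have -> : Rpower (beta * E t) k1 * Rpower s ((b - / 2) * k1) =
    Rpower s ((b - / 2) * k1) * Rpower (beta * E t) k1 by lra.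
  move=> Q.
  (* As [s >= 1], exponents may be compared: [(beta - 1) k1 / 2 + beta / 2 - 1 <= beta / 2] is
     exactly [bk]. *)
  have S : Rpower s ((b - / 2) * k1) * Rpower s (b - 1) <= Rpower s b.
    by rewrite -Rpower_plus; apply: Rle_Rpower; rewrite /b; lra.
  have K := Rpower_pos (beta * E t) k1.
  have S0 := Rpower_pos s (b - 1).
  have CE : 0 <= C * (E t * (2 * b) * (1 + 2 * Rabs (b - 1))) by apply: Rmult_le_pos; lra.
  apply: (Rle_trans _ (C * (E t * (2 * b) * (1 + 2 * Rabs (b - 1))) *
      (Rpower s ((b - / 2) * k1) * Rpower (beta * E t) k1 * Rpower s (b - 1)))).
    have -> : C * rpow (vnorm p) k1 * L = C * (E t * (2 * b) * (1 + 2 * Rabs (b - 1))) *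
      (rpow (vnorm p) k1 * Rpower s (b - 1)) by rewrite /L; ring.
    apply: Rmult_le_compat_l => //; apply: Rmult_le_compat_r; lra.
  have -> : E t * (C * (beta * (1 + 2 * Rabs (b - 1))) * Rpower (beta * E t) k1) * Rpower s b =
    C * (E t * (2 * b) * (1 + 2 * Rabs (b - 1))) * (Rpower (beta * E t) k1 * Rpower s b).
    have -> : 2 * b = beta by rewrite /b; lra.
    ring.
  apply: Rmult_le_compat_l => //; nra.
have chiterm : - a - E t * (C1 * beta * Rpower (beta * E t) (/ (beta - 1))) * Rpower s b
    <= chi t * rpow (vnorm p) sigma.
  have q1 : 0 < / (beta - 1) by apply: Rinv_0_lt_compat; lra.
  have qE : beta / (beta - 1) = / (beta - 1) + 1 by field; lra.
  have q0 : 0 < beta / (beta - 1) by rewrite qE; lra.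
  have := bound _ q0.
  (* The conjugate exponent makes this power of the gradient grow exactly like the barrier. *)
  have -> : (b - / 2) * (beta / (beta - 1)) = b by rewrite /b; field; lra.
  rewrite {2}qE Rpower_plus Rpower_1 // => Q.
  have Y := young _ p0.
  have r0 := rpow_ge0 (vnorm p) sigma.
  have : C1 * rpow (vnorm p) (beta / (beta - 1)) <=
    C1 * (Rpower (beta * E t) (/ (beta - 1)) * (beta * E t) * Rpower s b).
    by apply: Rmult_le_compat_l.
  have : - (M * rpow (vnorm p) sigma) <= chi t * rpow (vnorm p) sigma.
    have : - M <= chi t by split_Rabs; lra.
    nra.
  lra.
rewrite /Psigma; lra.
Qed.

Lemma growth_o_lower_bound n (u : Vec n -> R -> R) z T beta eps :
  growth_o u z T beta -> 0 < eps ->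
  exists R0, 0 < R0 /\ forall r, R0 <= r -> forall x t,
    vnorm (vsub x z) <= r -> 0 < t < T -> - (eps * Rpower r beta) <= u x t.
Proof.
move=> g e0; have [R0 [R00 R0P]] := g eps e0; exists R0; split=> // r rR x t xr tT.
have [S [[Sub _] SB]] := R0P r rR.
have : - u x t <= S by apply: Sub; exists x, t.
have := Rle_abs S; lra.
Qed.

(** Covers all cases of the theorem through [a], [C1], [M] and [beta]. A violation at [(x1, t1)]
    lets the parameters be chosen from its size; the minimum of [u - phi] is then interior, where
    [phi] is a strict sub-solution. *)
Lemma supersolution_lower_bound n (H : Vec n -> Mat n -> R) k1 T chi sigma Z
  (u : Vec n -> R -> R) z beta m a C1 M :
  H_continuous H -> condA H -> condB H k1 -> 0 < k1 -> 0 < T ->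
  1 < beta -> (beta - 1) * k1 <= 2 ->
  (forall t, 0 < t < T -> Rabs (chi t) <= M) ->
  0 <= a -> 0 <= C1 ->
  (forall y, 0 <= y -> M * rpow y sigma <= a + C1 * rpow y (beta / (beta - 1))) ->
  (forall r, 0 <= Z r) -> lsc_on T u -> visc_super H chi Z sigma T u ->
  (forall x, m <= u x 0) -> growth_o u z T beta ->
  forall x t, 0 < t < T -> m - a * t <= u x t.
Proof.
move=> Hc HA HB k0 T0 b1 bk chiM a0 C10 young Z0 lsc visc um gr x1 t1 t1T.
apply: Rnot_lt_le => gap.
have [C [C0 HC]] := H_neg_idm_lower_bound Hc HB k0.
set c1 := C * (beta * (1 + 2 * Rabs (beta / 2 - 1))).
have c10 : 0 <= c1.
  have := Rabs_pos (beta / 2 - 1) => ?.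
  by apply: Rmult_le_pos => //; apply: Rmult_le_pos; lra.
have c20 : 0 <= C1 * beta by apply: Rmult_le_pos; lra.
(* Each of the two error coefficients is kept below [1 / (4 T)]; together they give at most
   [1 / (2 T)], and [E <= 2 e0] turns this into the available gain [e0 / T]. *)
have tau0 : 0 < / (4 * T) by apply: Rinv_0_lt_compat; lra.
have q1 : 0 < / (beta - 1) by apply: Rinv_0_lt_compat; lra.
have [d1 [d10 d1P]] := Rpower_small c10 k0 tau0.
have [d2 [d20 d2P]] := Rpower_small c20 q1 tau0.
(* The gap is cut into [T + 3] units: [T] for the extra slope [eta * t], one for the exponential,
   one for the spatial term at [x1], one to spare. *)
pose eta := (m - a * t1 - u x1 t1) / (T + 3).
have eta0 : 0 < eta by apply: Rdiv_lt_0_compat; lra.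
have etaE : u x1 t1 = m - a * t1 - eta * (T + 3) by rewrite /eta; field; lra.
set v1 := Rpower (japanese z x1) (beta / 2).
have v10 : 0 < v1 by exact: Rpower_pos.
(* The first bound keeps [beta * E t] within the range of [d1P] and [d2P]; the second gives
   [E t1 * v1 <= eta]. *)
pose e0 := Rmin (Rmin d1 d2 / (2 * beta)) (eta / (2 * v1)).
have d120 : 0 < Rmin d1 d2 by exact: Rmin_pos.
have e00 : 0 < e0 by apply: Rmin_pos; apply: Rdiv_lt_0_compat; lra.
have e0d : 2 * beta * e0 <= Rmin d1 d2.
  have -> : Rmin d1 d2 = 2 * beta * (Rmin d1 d2 / (2 * beta)) by field; lra.
  by apply: Rmult_le_compat_l; [lra|exact: Rmin_l].
have e0eta : 2 * v1 * e0 <= eta.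
  have -> : eta = 2 * v1 * (eta / (2 * v1)) by field; lra.
  by apply: Rmult_le_compat_l; [lra|exact: Rmin_r].
(* Half the coefficient [e0] of the barrier: the other half is left to absorb the constant [m]. *)
have [R0 [R00 R0P]] := @growth_o_lower_bound _ _ _ _ _ (e0 / 2) gr ltac:(lra).
have n0 := vnorm_ge0 (vsub x1 z).
have m0 := Rabs_pos m; have mm := Rle_abs m.
have me0 : 0 <= 2 * Rabs m / e0 by apply: Rle_mult_inv_pos; lra.
(* Beyond [R1] the growth bound holds and [e0 |x - z|^beta > 2 |m|]; the last summand places [x1]
   inside the cylinder. *)
pose R1 := R0 + 1 + 2 * Rabs m / e0 + vnorm (vsub x1 z).
have R11 : 1 <= R1 by rewrite /R1; lra.
have P1 := Rpower_pos R1 beta.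
pose d := (T - t1) / 4; have d0 : 0 < d by rewrite /d; lra.
have ieta0 : 0 < / eta by exact: Rinv_0_lt_compat.
(* The summand [1 / eta] yields [exp (- N) <= eta]; the others push the barrier below the lower
   bound of [u] on the ball of radius [R1] at time [T']. *)
pose N := / eta + Rabs m + e0 * Rpower R1 beta.
have eP1 : 0 < e0 * Rpower R1 beta by exact: Rmult_lt_0_compat.
have N0 : 0 < N by rewrite /N; lra.
pose K := N / d; have K0 : 0 < K by exact: Rdiv_lt_0_compat.
have Kd : K * d = N by rewrite /K; field; lra.
(* The exponential is at most [eta] up to time [t1] and exceeds [N] at [T'],
   which keeps the minimum of [u - phi] away from the final time. *)
pose A t := m - (a + eta) * t - exp (K * (t - (t1 + d))).
pose A' t := - (a + eta) - K * exp (K * (t - (t1 + d))).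
pose E t := e0 * (1 + t / T).
have Ebnd t : 0 <= t <= T -> e0 <= E t <= 2 * e0.
  move=> tT; have t0 : 0 <= t / T by apply: Rle_mult_inv_pos; lra.
  have : t / T <= 1 by apply: (Rmult_le_reg_r T) => //; rewrite /Rdiv Rmult_assoc Rinv_l; lra.
  rewrite /E; nra.
have dexp t : derivable_pt_lim (fun s => exp (K * (s - (t1 + d)))) t (K * exp (K * (t - (t1 + d)))).
  pose g s := K * (s - (t1 + d)).
  rewrite Rmult_comm; apply: (@derivable_pt_lim_comp g exp); last exact: derivable_pt_lim_exp.
  have -> : K = K * (1 - 0) by lra.
  apply: (@derivable_pt_lim_scal (fun s => s - (t1 + d)) K).
  apply: (@derivable_pt_lim_minus id (fun _ => t1 + d)).
    exact: derivable_pt_lim_id.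
  exact: derivable_pt_lim_const.
have dlin (p q : R) t : derivable_pt_lim (fun s => p + q * s) t q.
  have {2}-> : q = 0 + q * 1 by lra.
  apply: (@derivable_pt_lim_plus (fun _ => p) (fun s => q * s)).
    exact: derivable_pt_lim_const.
  exact: derivable_pt_lim_scal (derivable_pt_lim_id t).
have C21phi : C21 (barrier (beta / 2) z A E) (Dbarrier (beta / 2) z E)
    (D2barrier (beta / 2) z E) (barrier (beta / 2) z A' (fun _ => e0 / T)).
  apply: C21_barrier.
  - move=> t; apply: (@derivable_pt_lim_minus (fun s => m - (a + eta) * s)
      (fun s => exp (K * (s - (t1 + d))))); last exact: dexp.
    by apply: (@derivable_pt_lim_ext (fun s => m + - (a + eta) * s)) => [s|]; [lra|exact: dlin].
  - move=> t; apply: (@derivable_pt_lim_ext (fun s => e0 + e0 / T * s)) => [s|]; last exact: dlin.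
    by rewrite /E; field; lra.
  - move=> t; apply: continuity_pt_minus; first exact: continuity_pt_const.
    apply: (@continuity_pt_scal (fun s => exp (K * (s - (t1 + d))))).
    by apply: derivable_continuous_pt; exists (K * exp (K * (t - (t1 + d)))); exact: dexp.
  - by move=> t; apply: continuity_pt_const.
set phi := barrier (beta / 2) z A E in C21phi *.
pose T' := t1 + 2 * d.
have T't : t1 < T' < T by rewrite /T' /d; lra.
have phic : jcont phi by case: C21phi => _ [_ [_ []]].
(* The margin 1 in the radius leaves a unit ball inside the box around any minimizer at distance
   less than [R1] from [z]. *)
have [||x t xB tI eps eps0|x0 [t0 [x0B [t0I xmin]]]] :=
  @box_cylinder_min _ z (R1 + 1) T' (fun x t => u x t - phi x t); try lra.
  have [r1 [r10 r1P]] := lsc x t ltac:(lra) (eps / 2) ltac:(lra).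
  have [r2 [r20 r2P]] := vnorm_small x r10.
  have [r3 [r30 r3P]] := phic x t (eps / 2) ltac:(lra).
  exists (Rmin r1 (Rmin r2 r3)); split; first by do 2 (apply: Rmin_pos => //).
  have l1 := Rmin_l r1 (Rmin r2 r3); have l2 := Rmin_r r1 (Rmin r2 r3).
  have l3 := Rmin_l r2 r3; have l4 := Rmin_r r2 r3.
  move=> y s sI yd sd.
  have U : u x t - eps / 2 < u y s.
    apply: r1P; [lra| |lra].
    by apply: r2P => i; have := yd i; lra.
  have : Rabs (phi y s - phi x t) < eps / 2.
    by apply: r3P => [i|]; [have := yd i|]; lra.
  split_Rabs; lra.
have neg : u x0 t0 < phi x0 t0.
  have F : u x1 t1 < phi x1 t1.
    have : exp (K * (t1 - (t1 + d))) <= eta.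
      have -> : K * (t1 - (t1 + d)) = - N by rewrite -Kd; ring.
      rewrite exp_Ropp -(Rinv_inv eta); apply: Rinv_le_contravar => //.
      have := exp_ineq1_le N; rewrite /N; lra.
    have [_ E2] := Ebnd t1 ltac:(lra).
    have : E t1 * v1 <= eta by nra.
    rewrite etaE /phi /barrier /A -/v1.
    have : eta * t1 < eta * T by apply: Rmult_lt_compat_l; lra.
    lra.
  have : u x0 t0 - phi x0 t0 <= u x1 t1 - phi x1 t1.
    apply: xmin => [i|]; last lra.
    by have := coord_le_vnorm (vsub x1 z) i; rewrite /R1 /vsub; lra.
  lra.
have et0 : 0 <= (a + eta) * t0 by apply: Rmult_le_pos; lra.
have [E1 E2] := Ebnd t0 ltac:(lra).
set w := Rpower (japanese z x0) (beta / 2).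
have w0 : 0 < w by exact: Rpower_pos.
have Ew : e0 * w <= E t0 * w by apply: Rmult_le_compat_r; lra.
have ew0 : 0 < e0 * w by exact: Rmult_lt_0_compat.
have phiE : phi x0 t0 <= m - exp (K * (t0 - (t1 + d))) - e0 * w.
  by rewrite /phi /barrier -/w /A; lra.
have ex0 := exp_pos (K * (t0 - (t1 + d))).
(* At time 0 the barrier lies strictly below [m], whereas [u >= m]. *)
have t00 : 0 < t0.
  case: (Rle_lt_or_eq_dec 0 t0 ltac:(lra)) => // E0.
  have := um x0; rewrite E0; lra.
(* Otherwise the growth bound at the radius [|x0 - z|] itself gives [u >= - e0 w / 2], which exceeds
   [m - e0 w] since [e0 w > 2 |m|]. *)
have x0R : vnorm (vsub x0 z) < R1.
  apply: Rnot_le_lt => xR.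
  have U := R0P (vnorm (vsub x0 z)) ltac:(rewrite /R1 in xR; lra) x0 t0 (Rle_refl _) ltac:(lra).
  have Pw : Rpower (vnorm (vsub x0 z)) beta <= w.
    (* This form of [beta] turns [r^beta] into [(r * r)^(beta / 2)], comparable with a power of
       [japanese]. *)
    have -> : beta = (1 + 1) * (beta / 2) by lra.
    rewrite -Rpower_mult Rpower_plus Rpower_1; last lra.
    by apply: Rpower_incr; rewrite ?vnorm_sqr -?vnorm_sqr /japanese -?vnorm_sqr; nra.
  have Pn : vnorm (vsub x0 z) <= Rpower (vnorm (vsub x0 z)) beta.
    rewrite -{1}(Rpower_1 (vnorm (vsub x0 z))); last lra.
    by apply: Rle_Rpower; lra.
  have : e0 * (2 * Rabs m / e0) < e0 * Rpower (vnorm (vsub x0 z)) beta.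
    by apply: Rmult_lt_compat_l => //; rewrite /R1 in xR; lra.
  have -> : e0 * (2 * Rabs m / e0) = 2 * Rabs m by field; lra.
  have : e0 * Rpower (vnorm (vsub x0 z)) beta <= e0 * w by apply: Rmult_le_compat_l; lra.
  lra.
have t0T : t0 < T'.
  case: (Rle_lt_or_eq_dec t0 T' ltac:(lra)) => // E0.
  have := R0P R1 ltac:(rewrite /R1; lra) x0 t0 (Rlt_le _ _ x0R) ltac:(lra).
  have : N <= exp (K * (t0 - (t1 + d))).
    have -> : K * (t0 - (t1 + d)) = N by rewrite E0 /T' -Kd; ring.
    have := exp_ineq1_le N; lra.
  rewrite /N; lra.
have := visc x0 t0 ltac:(lra) _ _ _ _ C21phi.
have touch : exists r, 0 < r /\ forall y s, vnorm (vsub y x0) < r -> Rabs (s - t0) < r ->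
    0 < s < T -> u x0 t0 - phi x0 t0 <= u y s - phi y s.
  exists (Rmin 1 (Rmin t0 (T' - t0))); split.
    by apply: Rmin_pos; [|apply: Rmin_pos]; lra.
  have l1 := Rmin_l 1 (Rmin t0 (T' - t0)); have l2 := Rmin_r 1 (Rmin t0 (T' - t0)).
  have l3 := Rmin_l t0 (T' - t0); have l4 := Rmin_r t0 (T' - t0).
  move=> y s yr sr sT; apply: xmin => [i|]; last by split_Rabs; lra.
  have y_i : Rabs (y i - x0 i) <= vnorm (vsub y x0) := coord_le_vnorm _ i.
  have x_i : Rabs (x0 i - z i) <= vnorm (vsub x0 z) := coord_le_vnorm _ i.
  have := Rabs_triang (y i - x0 i) (x0 i - z i).
  have -> : y i - x0 i + (x0 i - z i) = y i - z i by ring.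
  lra.
move/(_ touch).
have := @Psigma_barrier_ge n H chi Z k1 sigma beta z E C a M C1 x0 t0 (u x0 t0)
  (barrier (beta / 2) z A' (fun _ => e0 / T) x0 t0) HA k0 HC C0 b1 bk C10
  (chiM t0 ltac:(lra)) young ltac:(lra) (Z0 _).
rewrite -/c1 /barrier -/w /A'.
have bE2 : beta * E t0 <= beta * (2 * e0) by apply: Rmult_le_compat_l; lra.
have y0 : 0 < beta * E t0 by apply: Rmult_lt_0_compat; lra.
have l1 := Rmin_l d1 d2; have l2 := Rmin_r d1 d2.
have S1 := d1P (beta * E t0) ltac:(lra); have S2 := d2P (beta * E t0) ltac:(lra).
set S := c1 * _ + C1 * beta * _.
(* The gain from [E'] thus absorbs both errors, and the slope [-(a + eta)] absorbs [a]. The operator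
   is left at least [eta] plus a positive exponential term, contradicting the super-solution
   inequality. *)
have SB : E t0 * S * w <= e0 / T * w.
  apply: Rmult_le_compat_r; first lra.
  have SB : S <= / (2 * T).
    have -> : / (2 * T) = / (4 * T) + / (4 * T) by field; lra.
    rewrite /S; lra.
  have i0 : 0 < / (2 * T) by apply: Rinv_0_lt_compat; lra.
  have -> : e0 / T = 2 * e0 * / (2 * T) by field; lra.
  nra.
have : 0 < K * exp (K * (t0 - (t1 + d))) by exact: Rmult_lt_0_compat.
lra.
Qed.

(** * Choice of exponents and constants in the two growth regimes *)

Unset Implicit Arguments.

(* k = k1 + 1, gamma = k + 1 = k1 + 2, gamma^* = gamma/(gamma-2),
   sigma^* = sigma/(sigma-1) *)
Theorem theorem2p7 (n : nat) (H : Vec n -> Mat n -> R) (k1 : R)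
  (T : R) (h : Vec n -> R) (chi : R -> R) (sigma : R) (Z : R -> R)
  (u : Vec n -> R -> R) (z : Vec n) (beta : R) :
  (2 <= n)%nat ->
  H_continuous H -> condA H -> condB H k1 -> condC H ->
  1 < k1 + 1 ->
  0 < T ->
  vcont h -> (exists m, forall x, m <= h x) ->
  (forall t, 0 < t < T -> continuity_pt chi t) ->
  (exists M, forall t, 0 < t < T -> Rabs (chi t) <= M) ->
  0 <= sigma ->
  (forall r, 0 <= Z r) -> (forall r1 r2, r1 <= r2 -> Z r2 <= Z r1) -> continuity Z ->
  lsc_on T u ->
  visc_super H chi Z sigma T u ->
  (forall x, h x <= u x 0) ->
  growth_o u z T beta ->
  forall infh, is_glb (fun y => exists x, y = h x) infh ->
  (* (a) *)
  (sigma <= (k1 + 2) / 2 -> beta = (k1 + 2) / ((k1 + 2) - 2) ->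
     (sigma = 0 ->
        forall supchi, is_lub (fun y => exists s, 0 < s < T /\ y = Rabs (chi s)) supchi ->
        forall x t, 0 < t < T -> infh - t * supchi <= u x t) /\
     (0 < sigma -> forall x t, 0 < t < T -> infh <= u x t)) /\
  (* (b) *)
  ((k1 + 2) / 2 < sigma -> beta = sigma / (sigma - 1) ->
     forall x t, 0 < t < T -> infh <= u x t).
Proof.
move=> _ Hc HA HB _ k0 T0 _ _ _ [M chiM] s0 Z0 _ _ lsc visc hu gr infh [hinf _].
have um x : infh <= u x 0 by apply: Rle_trans (hu x); apply: hinf; exists x.
have {}k0 : 0 < k1 by lra.
have M0 : 0 <= M.
  have := chiM (T / 2) ltac:(lra); have := Rabs_pos (chi (T / 2)); lra.
(* The bound [M] is quantified anew because the case [sigma = 0] takes the exact supremum of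
   [|chi|]. *)
have key := fun a C1 M => @supersolution_lower_bound n H k1 T chi sigma Z u z beta
  infh a C1 M Hc HA HB k0 T0.
split=> [sle bE|slt bE x t tT].
(* For [beta = gamma^*] the constraint [(beta - 1) k1 <= 2] is an equality, and the conjugate
   exponent is [gamma / 2], the upper limit for [sigma]. *)
- have bE1 : beta - 1 = 2 / k1 by rewrite bE; field; lra.
  have b1 : 1 < beta by have : 0 < 2 / k1 by [apply: Rdiv_lt_0_compat; lra]; lra.
  have bk : (beta - 1) * k1 <= 2 by rewrite bE1; right; field; lra.
  have bconj : beta / (beta - 1) = (k1 + 2) / 2 by rewrite bE1 bE; field; lra.
  split=> [sE supchi [sub _] x t tT|sp x t tT].
    have chis r : 0 < r < T -> Rabs (chi r) <= supchi by move=> rT; apply: sub; exists r.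
    have sup0 : 0 <= supchi by have := chis t tT; have := Rabs_pos (chi t); lra.
    (* As [rpow y 0 = 1], the Young-type hypothesis holds with [a = M] and [C1 = 0]. *)
    have := key supchi 0 supchi b1 bk chis sup0 (Rle_refl 0).
    rewrite (Rmult_comm t); apply=> // y _; rewrite sE rpow_0r; lra.
  apply: Rnot_lt_le => gap.
  (* With this slope the loss [delta * t] is at most half the gap, which replaces a limit
     [delta -> 0]. *)
  pose delta := (infh - u x t) / (2 * T).
  have d0 : 0 < delta by apply: Rdiv_lt_0_compat; lra.
  have [C1 [C10 C1P]] := @young_rpow M sigma (beta / (beta - 1)) delta M0
    ltac:(rewrite bconj; lra) d0.
  have := key delta C1 M b1 bk chiM (Rlt_le _ _ d0) C10 C1P Z0 lsc visc um gr x t tT.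
  have : delta * t <= delta * T by apply: Rmult_le_compat_l; lra.
  have -> : delta * T = (infh - u x t) / 2 by rewrite /delta; field; lra.
  lra.
have s1 : 0 < sigma - 1 by lra.
have bE1 : beta - 1 = / (sigma - 1) by rewrite bE; field; lra.
have b1 : 1 < beta by have := Rinv_0_lt_compat _ s1; lra.
(* The claim reads [k1 <= 2 (sigma - 1)], which is [gamma / 2 <= sigma]. *)
have bk : (beta - 1) * k1 <= 2.
  rewrite bE1; apply: (Rmult_le_reg_l (sigma - 1)) => //.
  rewrite -Rmult_assoc Rinv_r; lra.
have bconj : beta / (beta - 1) = sigma by rewrite bE1 bE; field; lra.
(* The conjugate exponent is [sigma] itself, so the Young-type hypothesis is an identity with
   [a = 0] and [C1 = M]. *)
have := key 0 M M b1 bk chiM (Rle_refl 0) M0.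
rewrite bconj => /(_ ltac:(move=> y _; lra) Z0 lsc visc um gr x t tT); lra.
Qed.
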